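(* An s$\ell$-monoid $N$ is integral if and only if $N$ is isomorphic (as an s$\ell$-monoid) to the nuclear image $M_\gamma$ of some integral cancellative s$\ell$-monoid $M$ with respect to some nucleus $\gamma$ on $M$.
   Context: An s$\ell$-monoid is a structure $\langle M,\vee,\cdot,1\rangle$ where $\langle M,\vee\rangle$ is a join semilattice, $\langle M,\cdot,1\rangle$ is a monoid, and multiplication distributes over binary joins on both sides; it is ordered by its semilattice order. It is integral if $1$ is the top element, and cancellative if $ax\leq bx$ implies $a\leq b$ and $xa\leq xb$ implies $a\leq b$. A nucleus on $M$ is a monotone map $\gamma$ with $a\leq\gamma(a)=\gamma(\gamma(a))$ and $\gamma(a)\gamma(b)\leq\gamma(ab)$; the nuclear image $M_\gamma=\{a:\gamma(a)=a\}$ is an s$\ell$-monoid with inherited order, joins $\gamma(a\vee b)$, multiplication $\gamma(ab)$, unit $\gamma(1)$. *)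

(* Defs.v *)
From mathcomp Require Import ssreflect ssrfun.
From Stdlib Require Import ProofIrrelevance.

Set Implicit Arguments.
Unset Strict Implicit.
Unset Printing Implicit Defensive.

(* A plain record rather than a structure built on joinSemilatticeType and      *)
(* monoidType: those require a choiceType, and here the carrier is arbitrary.   *)
Record slmonoid := SLMonoid {
  slm_sort :> Type;
  slm_join : slm_sort -> slm_sort -> slm_sort;
  slm_mul : slm_sort -> slm_sort -> slm_sort;
  slm_one : slm_sort;
  slm_joinA : associative slm_join;
  slm_joinC : commutative slm_join;
  slm_joinxx : idempotent_op slm_join;
  slm_mulA : associative slm_mul;
  slm_mul1x : left_id slm_one slm_mul;
  slm_mulx1 : right_id slm_one slm_mul;
  slm_mulUl : left_distributive slm_mul slm_join;
  slm_mulUr : right_distributive slm_mul slm_join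
}.

Arguments slm_join {s} _ _ : rename.
Arguments slm_mul {s} _ _ : rename.
Arguments slm_one {s} : rename.

Declare Scope slm_scope.
Delimit Scope slm_scope with slm.
Local Open Scope slm_scope.

Notation "x ∨ y" := (slm_join x y) (at level 50, left associativity) : slm_scope.
Notation "x ⋅ y" := (slm_mul x y) (at level 40, left associativity) : slm_scope.

Definition slm_le (M : slmonoid) (x y : M) : Prop := x ∨ y = y.

Notation "x ≤ y" := (slm_le x y) (at level 70, no associativity) : slm_scope.

Definition integral (M : slmonoid) : Prop := forall x : M, x ≤ slm_one.

Definition cancellative (M : slmonoid) : Prop :=
  (forall a b x : M, a ⋅ x ≤ b ⋅ x -> a ≤ b) /\
  (forall a b x : M, x ⋅ a ≤ x ⋅ b -> a ≤ b).

Record nucleus (M : slmonoid) := Nucleus {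
  nucleus_fun :> M -> M;
  nucleus_mono : forall a b : M, a ≤ b -> nucleus_fun a ≤ nucleus_fun b;
  nucleus_ext : forall a : M, a ≤ nucleus_fun a;
  nucleus_idem : forall a : M, nucleus_fun (nucleus_fun a) = nucleus_fun a;
  nucleus_mul : forall a b : M,
    nucleus_fun a ⋅ nucleus_fun b ≤ nucleus_fun (a ⋅ b)
}.

Section OrderFacts.
Variable M : slmonoid.
Implicit Types x y z : M.

Lemma slm_lexx x : x ≤ x. Proof. exact: slm_joinxx. Qed.

Lemma slm_le_trans y x z : x ≤ y -> y ≤ z -> x ≤ z.
Proof. by rewrite /slm_le => xy yz; rewrite -yz slm_joinA xy. Qed.

Lemma slm_le_anti x y : x ≤ y -> y ≤ x -> x = y.
Proof. by rewrite /slm_le => xy yx; rewrite -xy slm_joinC yx. Qed.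

Lemma slm_leUl x y : x ≤ x ∨ y.
Proof. by rewrite /slm_le slm_joinA slm_joinxx. Qed.

Lemma slm_leUr x y : y ≤ x ∨ y.
Proof. by rewrite slm_joinC; exact: slm_leUl. Qed.

Lemma slm_leU x y z : x ≤ z -> y ≤ z -> x ∨ y ≤ z.
Proof. by rewrite /slm_le => xz yz; rewrite -slm_joinA yz. Qed.

Lemma slm_leM x x' y y' : x ≤ x' -> y ≤ y' -> x ⋅ y ≤ x' ⋅ y'.
Proof.
rewrite /slm_le => xx' yy'; apply: (@slm_le_trans (x' ⋅ y)).
  by rewrite /slm_le -slm_mulUl xx'.
by rewrite /slm_le -slm_mulUr yy'.
Qed.

End OrderFacts.

Section NuclearImage.
Variables (M : slmonoid) (g : nucleus M).
Implicit Types a b c : M.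

Lemma nucleus_joinl a b : g (g a ∨ b) = g (a ∨ b).
Proof.
apply: slm_le_anti.
  rewrite -[X in _ ≤ X]nucleus_idem; apply: nucleus_mono; apply: slm_leU.
    by apply: nucleus_mono; exact: slm_leUl.
  by apply: slm_le_trans (nucleus_ext g _); exact: slm_leUr.
apply: nucleus_mono; apply: slm_leU; last exact: slm_leUr.
exact: slm_le_trans (nucleus_ext g a) (slm_leUl _ _).
Qed.

Lemma nucleus_joinr a b : g (a ∨ g b) = g (a ∨ b).
Proof. by rewrite slm_joinC nucleus_joinl slm_joinC. Qed.

Lemma nucleus_mull a b : g (g a ⋅ b) = g (a ⋅ b).
Proof.
apply: slm_le_anti.
  rewrite -[X in _ ≤ X]nucleus_idem; apply: nucleus_mono.
  apply: slm_le_trans (nucleus_mul g _ _).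
  by apply: slm_leM (nucleus_ext g _); exact: slm_lexx.
by apply: nucleus_mono; apply: slm_leM (slm_lexx _); exact: nucleus_ext.
Qed.

Lemma nucleus_mulr a b : g (a ⋅ g b) = g (a ⋅ b).
Proof.
apply: slm_le_anti.
  rewrite -[X in _ ≤ X]nucleus_idem; apply: nucleus_mono.
  apply: slm_le_trans (nucleus_mul g _ _).
  by apply: slm_leM (slm_lexx _); exact: nucleus_ext.
by apply: nucleus_mono; apply: slm_leM (nucleus_ext g _); exact: slm_lexx.
Qed.

Definition nuclear_sort : Type := {a : M | g a = a}.

Definition nuclear_in a : nuclear_sort := exist _ (g a) (nucleus_idem g a).

Definition nuclear_join (x y : nuclear_sort) : nuclear_sort :=
  nuclear_in (sval x ∨ sval y).
Definition nuclear_mul (x y : nuclear_sort) : nuclear_sort :=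
  nuclear_in (sval x ⋅ sval y).
Definition nuclear_one : nuclear_sort := nuclear_in slm_one.

Lemma nuclear_inj (x y : nuclear_sort) : sval x = sval y -> x = y.
Proof.
case: x y => [a ga] [b gb] /= ab; case: _ / ab gb => gb.
by rewrite (proof_irrelevance _ ga gb).
Qed.

Lemma nuclear_joinA : associative nuclear_join.
Proof.
move=> x y z; apply: nuclear_inj => /=.
by rewrite nucleus_joinl nucleus_joinr slm_joinA.
Qed.

Lemma nuclear_joinC : commutative nuclear_join.
Proof. by move=> x y; apply: nuclear_inj; rewrite /= slm_joinC. Qed.

Lemma nuclear_joinxx : idempotent_op nuclear_join.
Proof. by case=> a ga; apply: nuclear_inj; rewrite /= slm_joinxx. Qed.

Lemma nuclear_mulA : associative nuclear_mul.
Proof.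
move=> x y z; apply: nuclear_inj => /=.
by rewrite nucleus_mull nucleus_mulr slm_mulA.
Qed.

Lemma nuclear_mul1x : left_id nuclear_one nuclear_mul.
Proof.
by case=> a ga; apply: nuclear_inj; rewrite /= nucleus_mull slm_mul1x.
Qed.

Lemma nuclear_mulx1 : right_id nuclear_one nuclear_mul.
Proof.
by case=> a ga; apply: nuclear_inj; rewrite /= nucleus_mulr slm_mulx1.
Qed.

Lemma nuclear_mulUl : left_distributive nuclear_mul nuclear_join.
Proof.
move=> x y z; apply: nuclear_inj => /=.
by rewrite nucleus_mull nucleus_joinl nucleus_joinr slm_mulUl.
Qed.

Lemma nuclear_mulUr : right_distributive nuclear_mul nuclear_join.
Proof.
move=> x y z; apply: nuclear_inj => /=.
by rewrite nucleus_mulr nucleus_joinl nucleus_joinr slm_mulUr.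
Qed.

Definition nuclear_image : slmonoid :=
  SLMonoid nuclear_joinA nuclear_joinC nuclear_joinxx nuclear_mulA
    nuclear_mul1x nuclear_mulx1 nuclear_mulUl nuclear_mulUr.

Lemma nuclear_leE (x y : nuclear_image) : x ≤ y <-> sval x ≤ sval y.
Proof.
split=> [xy | xy].
  have <- : sval (x ∨ y) = sval y by rewrite xy.
  exact: slm_le_trans (slm_leUl _ (sval y)) (nucleus_ext g _).
by apply: nuclear_inj; rewrite /= xy; exact: (svalP y).
Qed.

End NuclearImage.

Record slm_isomorphism (M N : slmonoid) (f : M -> N) : Prop := {
  slm_iso_bij : bijective f;
  slm_iso_join : {morph f : x y / x ∨ y};
  slm_iso_mul : {morph f : x y / x ⋅ y};
  slm_iso_one : f slm_one = slm_one
}.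

Definition slm_isomorphic (M N : slmonoid) : Prop :=
  exists f : M -> N, slm_isomorphism f.

(* Main.v *)
From mathcomp Require Import ssreflect ssrfun ssrbool.
From Stdlib Require Import List Arith ProofIrrelevance.
From Stdlib Require Import FunctionalExtensionality PropExtensionality.
Require Import Defs.

Set Implicit Arguments.
Unset Strict Implicit.
Unset Printing Implicit Defensive.

Local Open Scope slm_scope.
Local Open Scope list_scope.

Local Obligation Tactic := idtac.

(** Let [N] be integral. In the free monoid of words over [N], the nonempty
    two-sided ideals form, under union and concatenation, an integral
    sl-monoid whose unit is the set of all words. It is cancellative: if
    [A C] is contained in [B C] and [c] is a shortest word of [C], then for
    every [w] in [A] we have [w c = b c'] with [b] in [B] and [c'] in [C] no
    shorter than [c], so [b] is a prefix of [w] and [w] is in [B].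

    Let [M] consist of those ideals [A] for which the values in [N] of the words
    of [A] have a least upper bound that is the join of finitely many of them.
    Finiteness makes [M] closed under concatenation, with the bounds multiplying.
    Sending [A] with bound [n] to the ideal of all words of value at most [n]
    is a nucleus on [M] whose image is a copy of [N]. *)

(** * Two factorizations of one word *)

Lemma app_eq_prefix_or_shorter (T : Type) (u v u' v' : list T) :
  u ++ v = u' ++ v' ->
  (exists s, u = u' ++ s) \/ (length v' < length v)%nat.
Proof.
case/app_eq_app => s [[-> _]|[-> ->]]; first by left; exists s.
(* With an empty overlap [v'] is not shorter than [v], but then [u = u'], a case of the first
   alternative. *)
case: s => [|x s]; first by left; exists nil; rewrite !app_nil_r.
right; rewrite length_app /= -Nat.le_succ_l -Nat.succ_le_mono.
exact: Nat.le_add_l.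
Qed.

Lemma app_eq_suffix_or_shorter (T : Type) (u v u' v' : list T) :
  u ++ v = u' ++ v' ->
  (exists s, v = s ++ v') \/ (length u' < length u)%nat.
Proof.
case/app_eq_app => s [[-> ->]|[_ ->]]; last by left; exists s.
case: s => [|x s]; first by left; exists nil.
right; rewrite length_app /= Nat.add_succ_r -Nat.le_succ_l -Nat.succ_le_mono.
exact: Nat.le_add_r.
Qed.

(** * Word ideals and cancellation *)

Section Words.
Variable T : Type.
Implicit Types (A B C : list T -> Prop) (u v w : list T).

Definition word_ideal A := forall u v w, A v -> A (u ++ v ++ w).

Definition lang_cat A B w := exists u v, [/\ A u, B v & w = u ++ v].

Lemma word_ideal_catl A u v : word_ideal A -> A v -> A (u ++ v).
Proof. by move=> iA Av; rewrite -(app_nil_r v); exact: iA. Qed.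

Lemma word_ideal_catr A u v : word_ideal A -> A u -> A (u ++ v).
Proof. by move=> iA; exact: (iA nil). Qed.

Lemma word_ideal_lang_cat A B :
  word_ideal A -> word_ideal B -> word_ideal (lang_cat A B).
Proof.
move=> iA iB u _ w [a] [b] [Aa Bb ->].
exists (u ++ a), (b ++ w); split; last by rewrite !app_assoc.
  exact: word_ideal_catl.
exact: word_ideal_catr.
Qed.

Lemma lang_cat_cancelr A B C : word_ideal B -> (exists c, C c) ->
  (forall w, lang_cat A C w -> lang_cat B C w) -> forall w, A w -> B w.
Proof.
move=> iB [c Cc] sub w Aw.
(* Strong induction on the length of [c] stands in for a shortest word of [C]: a shorter [c'] is
   passed to [IH]. *)
elim/(Wf_nat.induction_ltof1 _ (@length T)): c Cc => c IH Cc.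
have [|b [c' [Bb Cc']]] := sub (w ++ c); first by exists w, c.
case/app_eq_prefix_or_shorter => [[s ->]|lt]; first exact: word_ideal_catr.
exact: IH lt Cc'.
Qed.

Lemma lang_cat_cancell A B C : word_ideal B -> (exists c, C c) ->
  (forall w, lang_cat C A w -> lang_cat C B w) -> forall w, A w -> B w.
Proof.
move=> iB [c Cc] sub w Aw.
elim/(Wf_nat.induction_ltof1 _ (@length T)): c Cc => c IH Cc.
have [|c' [b [Cc' Bb]]] := sub (c ++ w); first by exists c, w.
case/app_eq_suffix_or_shorter => [[s ->]|lt]; first exact: word_ideal_catl.
exact: IH lt Cc'.
Qed.

End Words.

(** * Word values and finite joins *)

Section IdealMonoid.
Variable N : slmonoid.
Hypothesis N_integral : integral N.
Implicit Types (n m : N) (u v w : list N) (P Q S : N -> Prop).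

Definition word_value w : N := fold_right slm_mul slm_one w.

Lemma word_value_cat u v :
  word_value (u ++ v) = word_value u ⋅ word_value v.
Proof.
by elim: u => /= [|x u ->]; rewrite ?slm_mul1x ?slm_mulA.
Qed.

Lemma word_value1 n : word_value (n :: nil) = n.
Proof. exact: slm_mulx1. Qed.

(** Only nonempty finite families are joined, as [N] need not have a least element. *)
Inductive join_closure P : N -> Prop :=
| join_closure_base n of P n : join_closure P n
| join_closure_join n m of join_closure P n & join_closure P m :
    join_closure P (n ∨ m).

Lemma join_closure_le P n m :
  (forall p, P p -> p ≤ m) -> join_closure P n -> n ≤ m.
Proof.
move=> ub; elim=> [p /ub //|p q _ pm _ qm]; exact: slm_leU.
Qed.

Lemma join_closure_sub P Q n :
  (forall p, P p -> Q p) -> join_closure P n -> join_closure Q n.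
Proof.
move=> sub; elim=> [p /sub|p q _ Qp _]; first exact: join_closure_base.
exact: join_closure_join.
Qed.

(** Distributivity over binary joins expands a product of two finite joins into a finite join of
    products. *)
Lemma join_closure_mul P Q S n m :
  (forall p q, P p -> Q q -> S (p ⋅ q)) ->
  join_closure P n -> join_closure Q m -> join_closure S (n ⋅ m).
Proof.
move=> PQS Pn Qm; elim: Pn => [p Pp|p p' _ IHp _ IHp'].
  elim: Qm => [q Qq|q q' _ IHq _ IHq']; first exact/join_closure_base/PQS.
  by rewrite slm_mulUr; exact: join_closure_join.
by rewrite slm_mulUl; exact: join_closure_join.
Qed.

Lemma join_closure_inhabited P n : join_closure P n -> exists p, P p.
Proof. by elim=> [p Pp|//]; exists p. Qed.

(** * Ideals with a finitely generated supremum *)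

Definition lang_values (A : list N -> Prop) n :=
  exists w, A w /\ word_value w = n.

(** The last two fields make [ideal_sup] the least upper bound of the values, so the words determine
    it; [ideal_supP] also forces the ideal to be nonempty. *)
Record sup_ideal := SupIdeal {
  ideal_mem :> list N -> Prop;
  ideal_sup : N;
  ideal_closed : word_ideal ideal_mem;
  ideal_ub : forall w, ideal_mem w -> word_value w ≤ ideal_sup;
  ideal_supP : join_closure (lang_values ideal_mem) ideal_sup
}.
Implicit Types A B C : sup_ideal.

Lemma ideal_sup_le A n : (forall w, A w -> word_value w ≤ n) ->
  ideal_sup A ≤ n.
Proof.
move=> ub; apply: join_closure_le (ideal_supP A) => _ [w [Aw <-]]; exact: ub.
Qed.

Lemma ideal_sup_mono A B : (forall w, A w -> B w) ->
  ideal_sup A ≤ ideal_sup B.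
Proof. by move=> sub; apply: ideal_sup_le => w /sub; exact: ideal_ub. Qed.

Lemma sup_ideal_ext A B : (forall w, A w <-> B w) -> A = B.
Proof.
move=> AB.
have sup_eq : ideal_sup A = ideal_sup B.
  by apply: slm_le_anti; apply: ideal_sup_mono => w /AB.
have mem_eq : ideal_mem A = ideal_mem B.
  by apply: functional_extensionality => w; exact/propositional_extensionality.
case: A B sup_eq mem_eq {AB} => [A n iA uA sA] [B m iB uB sB] /= nm AB.
subst m B; congr SupIdeal; exact: proof_irrelevance.
Qed.

Lemma sup_ideal_inhabited A : exists w, A w.
Proof. by have [_ [w [Aw _]]] := join_closure_inhabited (ideal_supP A); exists w. Qed.

Program Definition ideal_union A B : sup_ideal :=
  @SupIdeal (fun w => A w \/ B w) (ideal_sup A ∨ ideal_sup B) _ _ _.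
Next Obligation.
by move=> A B u v w [Av|Bv]; [left|right]; exact: ideal_closed.
Qed.
Next Obligation.
move=> A B w [/ideal_ub Aw|/ideal_ub Bw].
  exact: slm_le_trans Aw (slm_leUl _ _).
exact: slm_le_trans Bw (slm_leUr _ _).
Qed.
Next Obligation.
move=> A B; apply: join_closure_join.
  by apply: join_closure_sub (ideal_supP A) => n [w [Aw wn]]; exists w; split; [left|].
by apply: join_closure_sub (ideal_supP B) => n [w [Bw wn]]; exists w; split; [right|].
Qed.

Program Definition ideal_cat A B : sup_ideal :=
  @SupIdeal (lang_cat A B) (ideal_sup A ⋅ ideal_sup B) _ _ _.
Next Obligation.
by move=> A B; apply: word_ideal_lang_cat; exact: ideal_closed.
Qed.
Next Obligation.
move=> A B _ [u] [v] [Au Bv ->]; rewrite word_value_cat.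
by apply: slm_leM; exact: ideal_ub.
Qed.
Next Obligation.
move=> A B; apply: join_closure_mul (ideal_supP A) (ideal_supP B).
move=> _ _ [u [Au <-]] [v [Bv <-]]; exists (u ++ v).
by split; [exists u, v | exact: word_value_cat].
Qed.

Program Definition principal_ideal n : sup_ideal :=
  @SupIdeal (fun w => word_value w ≤ n) n _ _ _.
Next Obligation.
move=> n u v w vn; rewrite !word_value_cat; apply: slm_le_trans vn.
(* With the bound written as [slm_one ⋅ (word_value v ⋅ slm_one)], integrality allows a comparison
   factor by factor. *)
rewrite -[X in _ ≤ X]slm_mul1x -[word_value v in X in _ ≤ X]slm_mulx1.
by do !apply: slm_leM => //; exact: slm_lexx.
Qed.
Next Obligation. by []. Qed.
Next Obligation.
(* The bound is attained by a single one-letter word. *)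
move=> n; apply: join_closure_base; exists (n :: nil).
by rewrite word_value1; split=> //; exact: slm_lexx.
Qed.

Lemma principal_ideal1 w : principal_ideal slm_one w.
Proof. exact: N_integral. Qed.

(** * The sl-monoid of ideals *)

Lemma ideal_unionA : associative ideal_union.
Proof. by move=> A B C; apply: sup_ideal_ext => w /=; rewrite or_assoc. Qed.

Lemma ideal_unionC : commutative ideal_union.
Proof. by move=> A B; apply: sup_ideal_ext => w /=; exact: or_comm. Qed.

Lemma ideal_unionxx : idempotent_op ideal_union.
Proof. by move=> A; apply: sup_ideal_ext => w /=; split=> [[]|]; auto. Qed.

Lemma ideal_catA : associative ideal_cat.
Proof.
move=> A B C; apply: sup_ideal_ext => w /=; split.
  move=> [a] [_] [Aa [b] [c] [Bb Cc ->] ->].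
  by exists (a ++ b), c; split=> //; [exists a, b | rewrite app_assoc].
move=> [_] [c] [[a] [b] [Aa Bb ->] Cc ->].
by exists a, (b ++ c); split=> //; [exists b, c | rewrite app_assoc].
Qed.

(** Ideals absorb words on the left; conversely the empty word, of value [slm_one], splits off. *)
Lemma ideal_cat1x : left_id (principal_ideal slm_one) ideal_cat.
Proof.
move=> A; apply: sup_ideal_ext => w /=; split=> [[u] [v] [_ Av ->]|Aw].
  exact: word_ideal_catl (@ideal_closed A) Av.
by exists nil, w; split=> //; exact: slm_joinxx.
Qed.

Lemma ideal_catx1 : right_id (principal_ideal slm_one) ideal_cat.
Proof.
move=> A; apply: sup_ideal_ext => w /=; split=> [[u] [v] [Au _ ->]|Aw].
  exact: word_ideal_catr (@ideal_closed A) Au.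
by exists w, nil; rewrite app_nil_r; split=> //; exact: slm_joinxx.
Qed.

Lemma ideal_catUl : left_distributive ideal_cat ideal_union.
Proof.
move=> A B C; apply: sup_ideal_ext => w /=; split.
  by move=> [u] [v] [[Au|Bu] Cv ->]; [left|right]; exists u, v.
by move=> [[u] [v] [Hu Cv ->]|[u] [v] [Hu Cv ->]]; exists u, v; split; auto.
Qed.

Lemma ideal_catUr : right_distributive ideal_cat ideal_union.
Proof.
move=> C A B; apply: sup_ideal_ext => w /=; split.
  by move=> [u] [v] [Cu [Av|Bv] ->]; [left|right]; exists u, v.
by move=> [[u] [v] [Cu Hv ->]|[u] [v] [Cu Hv ->]]; exists u, v; split; auto.
Qed.

Definition ideal_monoid : slmonoid :=
  SLMonoid ideal_unionA ideal_unionC ideal_unionxx ideal_catA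
    ideal_cat1x ideal_catx1 ideal_catUl ideal_catUr.

Lemma ideal_leP (A B : ideal_monoid) :
  A ≤ B <-> forall w, ideal_mem A w -> ideal_mem B w.
Proof.
split=> [<- w Aw|sub]; first by left.
by apply: sup_ideal_ext => w /=; split=> [[/sub|]|]; auto.
Qed.

Lemma ideal_monoid_integral : integral ideal_monoid.
Proof. by move=> A; apply/ideal_leP => w _; exact: principal_ideal1. Qed.

Lemma ideal_monoid_cancellative : cancellative ideal_monoid.
Proof.
split=> A B C /ideal_leP sub; apply/ideal_leP.
  exact: lang_cat_cancelr (@ideal_closed B) (sup_ideal_inhabited C) sub.
exact: lang_cat_cancell (@ideal_closed B) (sup_ideal_inhabited C) sub.
Qed.

(** * The nucleus and its image *)

Definition principal_closure (A : ideal_monoid) : ideal_monoid :=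
  principal_ideal (ideal_sup A).

Program Definition ideal_nucleus : nucleus ideal_monoid :=
  @Nucleus ideal_monoid principal_closure _ _ _ _.
Next Obligation.
move=> A B /ideal_leP /ideal_sup_mono AB; apply/ideal_leP => w /= wA.
exact: slm_le_trans wA AB.
Qed.
Next Obligation. by move=> A; apply/ideal_leP => w; exact: ideal_ub. Qed.
(* [ideal_sup (principal_ideal n)] computes to [n]. *)
Next Obligation. by []. Qed.
Next Obligation.
move=> A B; apply/ideal_leP => _ [u] [v] [uA vB ->] /=.
by rewrite word_value_cat; exact: slm_leM.
Qed.

Definition nuclear_principal n : nuclear_image ideal_nucleus :=
  @nuclear_in ideal_monoid ideal_nucleus (principal_ideal n).

Lemma nuclear_principal_iso : slm_isomorphism nuclear_principal.
Proof.
split.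
(* The inverse takes the supremum: a fixed ideal is the principal ideal of its supremum. *)
- exists (fun x => ideal_sup (sval x)) => // x.
  by apply: (@nuclear_inj _ ideal_nucleus); exact: (svalP x).
(* The closure depends only on the supremum, so both sides compute to the same principal ideal. *)
- by move=> n m; exact: (@nuclear_inj _ ideal_nucleus).
- by move=> n m; exact: (@nuclear_inj _ ideal_nucleus).
- exact: (@nuclear_inj _ ideal_nucleus).
Qed.

End IdealMonoid.

(** * Integrality of nuclear images and isomorphic copies *)

Lemma nuclear_image_integral (M : slmonoid) (g : nucleus M) :
  integral M -> integral (nuclear_image g).
Proof.
move=> M_integral x; apply/nuclear_leE.
exact: slm_le_trans (M_integral _) (nucleus_ext g _).
Qed.

(** [x ≤ slm_one] is an equation between joins, which an injective morphism reflects. *)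
Lemma integral_isomorphic (M N : slmonoid) :
  slm_isomorphic M N -> integral N -> integral M.
Proof.
case=> f [bij_f fU _ f1] N_integral x; apply: (bij_inj bij_f).
by rewrite fU f1; exact: N_integral.
Qed.

Theorem theoremD (N : slmonoid) :
  integral N <->
  exists (M : slmonoid) (g : nucleus M),
    integral M /\ cancellative M /\ slm_isomorphic N (nuclear_image g).
Proof.
split=> [N_integral|[M] [g] [M_integral [_ iso]]].
  exists (ideal_monoid N_integral), (ideal_nucleus N_integral).
  split; first exact: ideal_monoid_integral.
  split; first exact: ideal_monoid_cancellative.
  by exists (nuclear_principal N_integral); exact: nuclear_principal_iso.
exact: integral_isomorphic iso (nuclear_image_integral M_integral).
Qed.
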